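(* Let $k\ge 1$ be an integer and let $C$ be a circle of length $1$. Consider the game $\Gamma'_k(C)$ played on $C$. An optimal strategy for the attacker is to choose a subinterval of length $1/(2k)$ uniformly randomly on the circle. An optimal strategy for the defender is to place the $k$ booby traps at equal distances on $C$. The value of the game is $1/(4k)$.
   Context: The game $\Gamma'_k(C)$ is the following zero-sum game. $C$ is a circle of total length $1$ with length measure $\lambda$. The defender has $k$ booby traps and chooses $k$ points of $C$ at which to place them. The attacker, aware of the presence of the $k$ booby traps but not of their locations, chooses a connected subset $S$ of $C$. The payoff to the attacker is $\lambda(S)$ if $S$ contains no booby trap, and $0$ otherwise; the attacker's objective is to maximize the expected payoff and the defender's is to minimize it. Players may use mixed (randomized) strategies. A strategy of the attacker (defender) is optimal if it guarantees an expected payoff of at least (at most) the value of the game against every strategy of the opponent.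
   Formalization: The defender's optimal strategy is taken to be placing the k booby traps at equal distances and rotating this configuration uniformly at random; a fixed equidistant placement would not be optimal, since the attacker could choose a gap and obtain 1/k. *)

(* Defs.v *)
From HB Require Import structures.
From mathcomp Require Import all_boot all_order all_algebra.
From mathcomp Require Import all_classical all_reals all_analysis.
Set Implicit Arguments.
Unset Strict Implicit.
Unset Printing Implicit Defensive.
Import Order.TTheory GRing.Theory Num.Theory.
Import numFieldNormedType.Exports.
Local Open Scope classical_set_scope.
Local Open Scope ring_scope.

(* The plane carries its product topology and its product (i.e. Borel)
   sigma-algebra; C is the circle of circumference 1 centred at the origin. *)
Notation plane R := (R * R)%type.

Definition circle (R : realType) : set (plane R) :=
  [set p | p.1 ^+ 2 + p.2 ^+ 2 = (pi *+ 2)^-1 ^+ 2].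
Arguments circle R _ : clear implicits.

(* Unit-speed, 1-periodic parametrization of the circle. *)
Definition circle_point (R : realType) (t : R) : plane R :=
  (cos (pi *+ 2 * t) / (pi *+ 2), sin (pi *+ 2 * t) / (pi *+ 2)).

(* lambda: as the parametrization has unit speed, the length of S is the
   Lebesgue measure of its parameters within one period. *)
Definition arc_length (R : realType) (S : set (plane R)) : \bar R :=
  lebesgue_measure (`[0, 1[ `&` @circle_point R @^-1` S).

Definition attacker_choice (R : realType) (S : set (plane R)) : Prop :=
  S `<=` circle R /\ connected S.

(* The traps are labelled and are allowed to coincide. *)
Definition defender_choice (R : realType) (k : nat) (x : 'I_k -> plane R) :
  Prop := forall i, circle R (x i).

Definition payoff (R : realType) (k : nat) (S : set (plane R))
    (x : 'I_k -> plane R) : \bar R :=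
  if `[< exists i, S (x i) >] then 0%E else arc_length S.

(* A randomized choice is a map defined on an arbitrary probability space;
   pure choices are the case of a one-point space. *)
Record attacker_random (R : realType) := AttackerRandom {
  a_disp : measure_display;
  a_space : measurableType a_disp;
  a_law : probability a_space R;
  a_set : a_space -> set (plane R) }.
Arguments a_set {R} _ _.

Record defender_random (R : realType) (k : nat) := DefenderRandom {
  d_disp : measure_display;
  d_space : measurableType d_disp;
  d_law : probability d_space R;
  d_traps : d_space -> 'I_k -> plane R }.
Arguments d_traps {R k} _ _ _.

(* Measurability of the graph is the usual requirement on a random set: it makes
   the payoff jointly measurable against any measurable choice of traps. *)
Definition attacker_strategy (R : realType) (sigma : attacker_random R) :
    Prop :=
  (forall w, attacker_choice (a_set sigma w)) /\
  measurable [set wp : a_space sigma * plane R | a_set sigma wp.1 wp.2].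

Definition defender_strategy (R : realType) (k : nat)
    (tau : defender_random R k) : Prop :=
  (forall w, defender_choice (d_traps tau w)) /\
  forall i, measurable_fun setT (fun w => d_traps tau w i).

(* The two players randomize independently, hence the product measure. *)
Definition expected_payoff (R : realType) (k : nat)
    (sigma : attacker_random R) (tau : defender_random R k) : \bar R :=
  (\int[a_law sigma \x d_law tau]_w
     payoff (a_set sigma w.1) (d_traps tau w.2))%E.

(* The sup/inf sets are spelled out with [exists] because the strategies, which
   range over all probability spaces, live in too large a universe for [set]. *)
Definition lower_value (R : realType) (k : nat) : \bar R :=
  ereal_sup [set v | exists2 sigma : attacker_random R,
    attacker_strategy sigma &
    v = ereal_inf [set u | exists2 tau : defender_random R k,
          defender_strategy tau & u = expected_payoff sigma tau]].

Definition upper_value (R : realType) (k : nat) : \bar R :=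
  ereal_inf [set v | exists2 tau : defender_random R k,
    defender_strategy tau &
    v = ereal_sup [set u | exists2 sigma : attacker_random R,
          attacker_strategy sigma & u = expected_payoff sigma tau]].

Definition is_game_value (R : realType) (k : nat) (v : \bar R) : Prop :=
  lower_value R k = v /\ upper_value R k = v.

Definition attacker_optimal (R : realType) (k : nat)
    (sigma : attacker_random R) : Prop :=
  attacker_strategy sigma /\
  exists2 v, is_game_value k v &
    forall tau : defender_random R k,
      defender_strategy tau -> (v <= expected_payoff sigma tau)%E.

Definition defender_optimal (R : realType) (k : nat)
    (tau : defender_random R k) : Prop :=
  defender_strategy tau /\
  exists2 v, is_game_value k v &
    forall sigma : attacker_random R,
      attacker_strategy sigma -> (expected_payoff sigma tau <= v)%E.

(* The closed arc of length l whose initial point is uniform on the circle. *)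
Definition uniform_interval (R : realType) (l : R) : attacker_random R :=
  AttackerRandom (uniform_prob (@ltr01 R))
    (fun t => @circle_point R @` `[t, t + l]).

(* The equally spaced configuration of k traps, rotated uniformly at random
   (a deterministic placement would leave an arc of length 1/k safe). *)
Definition equidistant_traps (R : realType) (k : nat) : defender_random R k :=
  DefenderRandom (uniform_prob (@ltr01 R))
    (fun t (i : 'I_k) => circle_point (t + i%:R / k%:R)).

(* Main.v *)
Require Import Defs.
From mathcomp Require Import all_boot all_order all_algebra.
From mathcomp Require Import all_classical all_reals all_analysis.
From mathcomp Require Import measurable_realfun ring lra.
Import Order.TTheory GRing.Theory Num.Theory.
Import numFieldNormedType.Exports.
Local Open Scope classical_set_scope.
Local Open Scope ring_scope.

(* A uniformly random arc of length l = 1/(2k) contains a given point with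
   probability l, hence contains one of k given points with probability at most
   k l = 1/2, and the attacker gets at least l / 2 = 1/(4k).  Conversely, let S
   be a connected set that some rotation of the equidistant configuration misses
   (otherwise the payoff vanishes).  Then S lies in a gap W of length d = 1/k
   between consecutive traps.  The set T of all rotations that miss S is
   d-periodic, so it has measure k |T \cap W|, and T \cap W avoids S, so the
   expected payoff is at most k (d - p) p <= k (d / 2)^2 = 1/(4k), where
   p = |T \cap W|. *)

(** * Reduction modulo a period *)

Lemma periodic_int (R : pzRingType) (T : Type) (f : R -> T) (d : R) (m : int) :
  (forall x, f (x + d) = f x) -> forall x, f (x + m%:~R * d) = f x.
Proof.
move=> fd x.
have fn (n : nat) y : f (y + n%:R * d) = f y.
  elim: n => [|n IH]; first by rewrite mul0r addr0.
  by rewrite -natr1 mulrDl mul1r addrA fd.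
case: m => n; first exact: fn.
by rewrite NegzE mulrNz mulNr -[LHS](fn n.+1) subrK.
Qed.

Lemma int_window (R : archiRealFieldType) (a d u : R) : 0 < d ->
  exists m : int, a <= u + m%:~R * d < a + d.
Proof.
move=> d0; exists (- Num.floor ((u - a) / d)).
have /andP[] := floor_itv ((u - a) / d); set n := Num.floor _.
rewrite ler_pdivlMr// ltr_pdivrMr// mulrNz intrD mulrDl mulr1z mul1r => lo hi.
by apply/andP; split; lra.
Qed.

Lemma twopi_gt0 (R : realType) : 0 < pi *+ 2 :> R.
Proof. by rewrite pmulrn_lgt0// pi_gt0. Qed.

(** * The circle, its parametrization and its arcs *)

Section circle.
Context (R : realType).
Let twopi0 := twopi_gt0 R.
Implicit Types (t u m l : R) (p : plane R).

Lemma circle_pointD1 t : circle_point (t + 1) = circle_point t.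
Proof. by rewrite /circle_point mulrDr mulr1 cosD2pi sinD2pi. Qed.

Lemma circle_pointDz t (n : int) : circle_point (t + n%:~R) = circle_point t.
Proof. by rewrite -[n%:~R]mulr1 periodic_int//; exact: circle_pointD1. Qed.

Lemma circle_circle_point t : circle R (circle_point t).
Proof.
by rewrite /circle/= !exprMn -mulrDl cos2Dsin2 mul1r.
Qed.

(** [acos] of the rescaled abscissa gives the angle up to sign, and the sign of the ordinate decides
    between the two. *)
Lemma circle_pointP p : circle R p -> exists t, p = circle_point t.
Proof.
case: p => x y; rewrite /circle/= => xy.
have h : (x * (pi *+ 2)) ^+ 2 + (y * (pi *+ 2)) ^+ 2 = 1.
  by rewrite !exprMn -mulrDl xy -exprMn mulVf ?expr1n// gt_eqF.
set c := x * (pi *+ 2) in h; set s := y * (pi *+ 2) in h.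
have c1 : -1 <= c <= 1.
  rewrite -ler_norml -(@expr_le1 _ 2)// real_normK ?num_real//.
  by have := sqr_ge0 s; lra.
have cosc : cos (acos c) = c by apply: acosK; rewrite in_itv.
have sinc : sin (acos c) = `|s|.
  by rewrite sin_acos// -h addrAC subrr add0r sqrtr_sqr.
have E t : cos t = c -> sin t = s -> (x, y) = circle_point (t / (pi *+ 2)).
  move=> ct st; rewrite /circle_point mulrCA divff ?gt_eqF// mulr1 ct st.
  by rewrite /c /s !mulfK// gt_eqF.
have [s0|s0] := leP 0 s.
  by exists (acos c / (pi *+ 2)); apply: E; rewrite // sinc ger0_norm.
exists (- acos c / (pi *+ 2)); apply: E; rewrite ?cosN// sinN sinc.
by rewrite ltr0_norm// opprK.
Qed.

(* Up to the positive factor [2 * pi], the scalar product of [p] with the point of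
   parameter [m]: superlevel sets of it on the circle are the arcs centred at [m]. *)
Definition scal m p : R :=
  p.1 * cos (pi *+ 2 * m) + p.2 * sin (pi *+ 2 * m).

Lemma scal_circle_point m u :
  scal m (circle_point u) = cos (pi *+ 2 * (u - m)) / (pi *+ 2).
Proof. by rewrite /scal/= mulrBr cosB; ring. Qed.

Let cos_norm u : cos (pi *+ 2 * u) = cos (pi * (2 * `|u|)).
Proof.
have -> : pi * (2 * `|u|) = pi *+ 2 * `|u| by rewrite -[pi *+ 2]mulr_natl; ring.
by case: (ger0P u) => // _; rewrite mulrN cosN.
Qed.

Let pi_scaled_itv l : 0 <= l <= 1 -> pi * l \in `[0, pi].
Proof.
move=> /andP[l0 l1]; have pi0 := pi_gt0 R.
by rewrite in_itv/=; apply/andP; split; nra.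
Qed.

Let norm_window u : `|u| <= 2^-1 -> 0 <= 2 * `|u| <= 1.
Proof. by move=> u1; have := normr_ge0 u; lra. Qed.

(** Cosine is even and strictly decreasing on [[0, pi]]; up to sign, the angle of a [u] within half
    a turn of 0 lies there. *)
Lemma ltr_cos_window l u : 0 <= l <= 1 -> `|u| <= 2^-1 ->
  (cos (pi * l) < cos (pi *+ 2 * u)) = (`|u| < l / 2).
Proof.
move=> l01 /norm_window u1; rewrite cos_norm ltr_cos ?pi_scaled_itv//.
by rewrite ltr_pM2l ?pi_gt0// [2 * _]mulrC ltr_pdivlMr.
Qed.

Lemma ler_cos_window l u : 0 <= l <= 1 -> `|u| <= 2^-1 ->
  (cos (pi * l) <= cos (pi *+ 2 * u)) = (`|u| <= l / 2).
Proof.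
move=> l01 /norm_window u1; rewrite cos_norm leNgt ltr_cos ?pi_scaled_itv//.
by rewrite ltr_pM2l ?pi_gt0// [2 * _]mulrC -leNgt ler_pdivlMr.
Qed.

Lemma circle_point_near m u :
  exists2 v, circle_point v = circle_point u & `|v - m| <= 2^-1.
Proof.
have [n] := int_window _ (m - 2^-1) 1 u ltr01.
rewrite mulr1 => /andP[lo hi]; exists (u + n%:~R); first exact: circle_pointDz.
by rewrite ler_norml; apply/andP; split; lra.
Qed.

(** With the parameter of [p] taken within half a turn of the midpoint [t + l / 2], membership is a
    comparison of cosines. Cutting the arc off by a half-plane makes membership jointly measurable
    in [t] and [p]. *)
Lemma arcE t l : 0 <= l <= 1 -> @circle_point R @` `[t, t + l] =
  [set p | circle R p /\ cos (pi * l) / (pi *+ 2) <= scal (t + l / 2) p].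
Proof.
move=> l01; apply/seteqP; split => p /=.
  move=> [u]; rewrite in_itv/= => /andP[tu ul] <-.
  split; first exact: circle_circle_point.
  rewrite scal_circle_point ler_pM2r ?invr_gt0// ler_cos_window//.
    by rewrite ler_norml; apply/andP; split; lra.
  by rewrite ler_norml; apply/andP; split; lra.
move=> [/circle_pointP[u ->]].
have [v <- vw] := circle_point_near (t + l / 2) u.
rewrite scal_circle_point ler_pM2r ?invr_gt0// ler_cos_window//.
rewrite ler_norml => /andP[lo hi]; exists v => //.
by rewrite in_itv/=; apply/andP; split; lra.
Qed.

End circle.

(** * Lebesgue measure of periodic sets *)

Section lebesgue_periodic.
Context (R : realType).
Local Notation mu := (@lebesgue_measure R).
Implicit Types (A : set R) (a b c d : R).

Lemma measurable_shift A c :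
  measurable A -> measurable ((fun x : R => x + c) @^-1` A).
Proof.
move=> mA; rewrite -[X in measurable X]setTI.
by apply: (measurable_funD _ (measurable_cst c)) => //; exact: measurable_id.
Qed.

(** The pushforward by the translation agrees with [mu] on half-open intervals, which determine
    [mu]. *)
Lemma lebesgue_measure_shift A c : measurable A ->
  mu ((fun x : R => x + c) @^-1` A) = mu A.
Proof.
move=> mA.
pose f (x : measurableTypeR R) : measurableTypeR R := x + c.
have mf : measurable_fun setT f.
  by move=> _ B mB; rewrite setTI; exact: measurable_shift.
suff -> : mu A = pushforward mu f A by [].
apply: lebesgue_measure_unique => //= _ [[a b]] _ <-.
rewrite /pushforward /f.
have -> : (fun x : R => x + c) @^-1` `]a, b] = [set` `]a - c, b - c]].
  by apply/seteqP; split => x /=; rewrite !in_itv/= ltrBlDr lerBrDr.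
rewrite !lebesgue_measure_itv/= !lte_fin ltrD2r; case: ifP => // _.
by rewrite -!EFinD; congr EFin; ring.
Qed.

Section periodic.
Context (A : set R) (d : R).
Context (d0 : 0 < d) (mA : measurable A) (Ad : forall x, A (x + d) = A x).

Let shift_itv a b (m : int) :
  mu (`[a + m%:~R * d, b + m%:~R * d[ `&` A) = mu (`[a, b[ `&` A).
Proof.
rewrite -(lebesgue_measure_shift _ (m%:~R * d)); last exact: measurableI.
congr mu; apply/seteqP; split => x /=;
  by rewrite !in_itv/= lerD2r ltrD2r (periodic_int _ _ _ _ m Ad).
Qed.

Let split_itv a b c : a <= b -> b <= c ->
  mu (`[a, c[ `&` A) = (mu (`[a, b[ `&` A) + mu (`[b, c[ `&` A))%E.
Proof.
move=> ab bc; rewrite -measureU//; [|exact: measurableI|exact: measurableI|].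
  rewrite -setIUl; congr (mu (_ `&` _)); apply/seteqP.
  split => x /=; rewrite !in_itv/=.
    by move=> /andP[ax xc]; case: (ltP x b) => xb; [left|right]; apply/andP.
  by move=> [/andP[ax xb]|/andP[bx xc]]; apply/andP; split => //; lra.
apply/seteqP; split => x //= [[+ _] [+ _]]; rewrite !in_itv/=.
by move=> /andP[_ xb] /andP[]; rewrite leNgt xb.
Qed.

(** Let [y] be the multiple of [d] in [[x, x + d[]. Moving the piece [[x, y[] by one period to [[x +
    d, y + d[] turns the window at [x] into the one at [y], which is a translate of [[0, d[] by a
    multiple of [d]. *)
Lemma lebesgue_periodic_window a b :
  mu (`[a, a + d[ `&` A) = mu (`[b, b + d[ `&` A).
Proof.
suff H x : mu (`[x, x + d[ `&` A) = mu (`[0, d[ `&` A) by rewrite !H.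
have [m /andP[lo hi]] := int_window _ x d 0 d0.
have := shift_itv 0 d m; move: lo hi; set y := 0 + _ => lo hi <-.
have -> : d + m%:~R * d = y + d by rewrite /y; ring.
rewrite (split_itv _ y (x + d)) ?(ltW hi)//.
rewrite (split_itv y (x + d) (y + d)) ?lerD2r ?(ltW hi)//.
rewrite addeC; congr (_ + _)%E.
by have := shift_itv x y 1; rewrite mul1r.
Qed.

Lemma lebesgue_periodic_mul (n : nat) :
  mu (`[0, n%:R * d[ `&` A) = (n%:R%:E * mu (`[0%R, d[ `&` A))%E.
Proof.
elim: n => [|n IH].
  by rewrite mul0r set_itvE set0I measure0 mul0e.
rewrite -natr1 mulrDl mul1r (split_itv 0 (n%:R * d)); last 2 first.
- by rewrite mulr_ge0// ltW.
- by rewrite lerDl ltW.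
rewrite IH EFinD ge0_muleDl ?lee_fin// mul1e; congr (_ + _)%E.
by rewrite (lebesgue_periodic_window (n%:R * d) 0) add0r.
Qed.

End periodic.

Lemma uniform_prob01E A : measurable A ->
  uniform_prob (@ltr01 R) A = mu (`[0, 1[ `&` A).
Proof.
move=> mA; rewrite /uniform_prob integral_uniform_pdf.
rewrite (eq_integral (cst 1%E)); last first.
  move=> x; rewrite inE/= => -[_]; rewrite in_itv/= /uniform_pdf => ->.
  by rewrite subr0 invr1.
rewrite integral_cst//=; last exact: measurableI.
(* The density lives on the closed unit interval; its endpoint [1] is split off as a null set. *)
rewrite mul1e -(@setUitv1 _ _ (BLeft 0) 1 true) ?bnd_simp// setIUr measureU//=.
- rewrite [X in (_ + X)%E](_ : _ = 0)%E ?adde0 1?setIC//.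
  apply/eqP; rewrite eq_le measure_ge0 andbT.
  rewrite -[leRHS](lebesgue_measure_set1 (1 : R)).
  by apply: le_measure; rewrite ?inE//; exact: measurableI.
- exact: measurableI.
- exact: measurableI.
- apply/seteqP; split => x //= [] [_ +] [_ x1]; rewrite x1.
  by rewrite in_itv/= ltxx andbF.
Qed.

End lebesgue_periodic.

(** * Measurability and uniformly random arcs *)

Section strategies.
Context (R : realType).
Let twopi0 := twopi_gt0 R.
Local Notation mu := (@lebesgue_measure R).
Local Notation unif := (uniform_prob (@ltr01 R)).

Lemma measurable_cos : measurable_fun setT (@cos R).
Proof. by apply: continuous_measurable_fun; exact: continuous_cos. Qed.

Lemma measurable_sin : measurable_fun setT (@sin R).
Proof. by apply: continuous_measurable_fun; exact: continuous_sin. Qed.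

Lemma continuous_circle_point : continuous (@circle_point R).
Proof.
move=> u.
have c2 : pi *+ 2 * x @[x --> u] --> pi *+ 2 * u.
  by apply: cvgM; [exact: cvg_cst|exact: cvg_id].
have ccos : cos (pi *+ 2 * x) @[x --> u] --> cos (pi *+ 2 * u).
  by apply: continuous_cvg => //; exact: continuous_cos.
have csin : sin (pi *+ 2 * x) @[x --> u] --> sin (pi *+ 2 * u).
  by apply: continuous_cvg => //; exact: continuous_sin.
exact: (cvg_pair (cvgM ccos (cvg_cst _)) (cvgM csin (cvg_cst _))).
Qed.

Lemma continuous_scal (m : R) : continuous (scal R m).
Proof.
move=> p; apply: cvgD; apply: cvgM; try exact: cvg_cst.
  exact: cvg_fst.
exact: cvg_snd.
Qed.

Lemma measurable_circle_point : measurable_fun setT (@circle_point R).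
Proof.
apply: measurable_fun_pair; apply: measurable_funM => //.
  by apply: measurableT_comp; [exact: measurable_cos|exact: measurable_funM].
by apply: measurableT_comp; [exact: measurable_sin|exact: measurable_funM].
Qed.

Lemma arc_circle_point (u t l : R) : 0 <= l <= 1 ->
  (@circle_point R @` `[t, t + l]) (circle_point u) =
  (cos (pi * l) <= cos (pi *+ 2 * (u - (t + l / 2)))).
Proof.
move=> l01; rewrite arcE//= scal_circle_point ler_pM2r ?invr_gt0//.
by apply/propext; split => [[]//|]; split => //; exact: circle_circle_point.
Qed.

Lemma measurable_cos_window (m l : R) :
  measurable [set u : R | cos (pi * l) <= cos (pi *+ 2 * (u - m))].
Proof.
rewrite -[X in measurable X]setTI.
apply: (measurable_fun_ler (measurable_cst (cos (pi * l))) _ measurableT) => //.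
apply: measurableT_comp; first exact: measurable_cos.
by apply: measurable_funM => //; exact: measurable_funB.
Qed.

(** Periodicity replaces [[0, 1[] by the unit window centred at [m], where the condition says that
    [u] is within [l / 2] of [m]. As [l < 1], this closed interval fits into the half-open
    window. *)
Lemma lebesgue_cos_window (m l : R) : 0 <= l < 1 ->
  mu (`[0, 1[ `&` [set u | cos (pi * l) <= cos (pi *+ 2 * (u - m))]) = l%:E.
Proof.
move=> /andP[l0 l1]; set A := (X in _ `&` X).
have A1 u : A (u + 1) = A u.
  rewrite /A/mkset (_ : pi *+ 2 * (u + 1 - m) = pi *+ 2 * (u - m) + pi *+ 2).
    by rewrite cosD2pi.
  by ring.
have mA : measurable A by exact: measurable_cos_window.
have := lebesgue_periodic_window _ A 1 ltr01 mA A1 0 (m - 2^-1).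
rewrite add0r => ->.
rewrite (_ : _ `&` _ = `[m - l / 2, m + l / 2]%classic).
  rewrite lebesgue_measure_itv/= lte_fin; case: ifPn => [_|].
    by rewrite -EFinD; congr EFin; lra.
  by rewrite -leNgt => h; congr EFin; lra.
have l01 : 0 <= l <= 1 by rewrite l0 ltW.
apply/seteqP; split => u; rewrite /A/= !in_itv/=.
  move=> [/andP[lo hi]]; rewrite ler_cos_window//.
    by rewrite ler_norml => /andP[? ?]; apply/andP; split; lra.
  by rewrite ler_norml; apply/andP; split; lra.
move=> /andP[lo hi]; split; first by apply/andP; split; lra.
by rewrite ler_cos_window// ler_norml; apply/andP; split; lra.
Qed.

Lemma arc_length_arc (t l : R) : 0 <= l < 1 ->
  arc_length (@circle_point R @` `[t, t + l]) = l%:E.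
Proof.
move=> l01; rewrite -(lebesgue_cos_window (t + l / 2) l l01) /arc_length.
congr (mu (_ `&` _)); apply/funext => u; apply: arc_circle_point.
by case/andP: l01 => -> /ltW ->.
Qed.

(** Cosine being even, the point and the start of the arc can exchange roles: for the point of
    parameter [u], the suitable [t] form, modulo 1, a window of length [l] centred at
    [u - l / 2]. *)
Lemma uniform_arc_mem (p : plane R) (l : R) : 0 <= l < 1 -> circle R p ->
  measurable [set t | (@circle_point R @` `[t, t + l]) p] /\
  unif [set t | (@circle_point R @` `[t, t + l]) p] = l%:E.
Proof.
move=> l01 /circle_pointP[u ->].
have -> : [set t | (@circle_point R @` `[t, t + l]) (circle_point u)] =
          [set t | cos (pi * l) <= cos (pi *+ 2 * (t - (u - l / 2)))].
  apply/funext => t.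
  transitivity (cos (pi * l) <= cos (pi *+ 2 * (u - (t + l / 2))) : Prop).
    by apply: arc_circle_point; case/andP: l01 => -> /ltW ->.
  rewrite /mkset -[cos (pi *+ 2 * (u - _))]cosN -mulrN.
  by congr (is_true (_ <= cos (_ * _))); ring.
split; first exact: measurable_cos_window.
rewrite uniform_prob01E; last exact: measurable_cos_window.
exact: lebesgue_cos_window.
Qed.

(** An arc is connected as a continuous image of a segment; by [arcE] the graph is cut out by an
    equation and an inequality between measurable functions of [(t, p)]. *)
Lemma uniform_interval_strategy (l : R) : 0 <= l < 1 ->
  attacker_strategy (uniform_interval l).
Proof.
move=> l01; have l01' : 0 <= l <= 1 by case/andP: l01 => -> /ltW ->.
split=> [t|] /=.
  split; first by rewrite arcE//= => p /= [].
  apply: connected_continuous_connected; first exact: segment_connected.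
  by apply: continuous_subspaceT; exact: continuous_circle_point.
rewrite [X in measurable X](_ : _ =
    [set x : R * plane R | circle R x.2] `&`
    [set x | cos (pi * l) / (pi *+ 2) <= scal R (x.1 + l / 2) x.2]); last first.
  by apply/funext => -[t p]; exact: (congr1 (fun A => A p) (arcE R t l l01')).
have m2 : measurable_fun setT (fun x : R * plane R => x.2.1).
  exact: (measurableT_comp measurable_fst measurable_snd).
have m3 : measurable_fun setT (fun x : R * plane R => x.2.2).
  exact: (measurableT_comp measurable_snd measurable_snd).
have m1 : measurable_fun setT (fun x : R * plane R => pi *+ 2 * (x.1 + l / 2)).
  by apply: measurable_funM => //; exact: measurable_funD.
apply: measurableI.
  rewrite [X in measurable X](_ : _ =
      setT `&` (fun x : R * plane R =>
        x.2.1 ^+ 2 + x.2.2 ^+ 2 == (pi *+ 2)^-1 ^+ 2) @^-1` [set true]).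
    apply: measurable_fun_eqr => //.
    by apply: measurable_funD; exact: measurable_funX.
  by rewrite setTI; apply/seteqP; split => x /= /eqP.
rewrite -[X in measurable X]setTI.
apply: measurable_fun_ler => //.
apply: measurable_funD; apply: measurable_funM => //.
  by apply: measurableT_comp m1; exact: measurable_cos.
by apply: measurableT_comp m1; exact: measurable_sin.
Qed.

End strategies.

(** * Expected payoffs and the two guarantees *)

Section game.
Context (R : realType) (k : nat).
Let twopi0 := twopi_gt0 R.
Local Notation mu := (@lebesgue_measure R).
Local Notation unif := (uniform_prob (@ltr01 R)).

(** Arc lengths are the measures of the sections of [B], the graph of the random set pulled back
    along the parametrization. *)
Lemma measurable_arc_length (sigma : attacker_random R) :
  attacker_strategy sigma ->
  measurable_fun setT (fun w => arc_length (a_set sigma w)).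
Proof.
move=> [_ mS].
pose B : set (a_space sigma * measurableTypeR R) :=
  [set x | `[0, 1[%classic x.2 /\ a_set sigma x.1 (circle_point x.2)].
have mB : measurable B.
  apply: measurableI.
    by rewrite -[X in measurable X]setTI; exact: measurable_snd.
  rewrite -[X in measurable X]setTI.
  have mf : measurable_fun setT
      (fun x : a_space sigma * measurableTypeR R => (x.1, circle_point (x.2 : R))).
    apply: measurable_fun_pair; first exact: measurable_fst.
    exact: (measurableT_comp (measurable_circle_point R) measurable_snd).
  by apply: (mf measurableT [set x | a_set sigma x.1 x.2]).
rewrite (_ : (fun _ => _) = mu \o xsection B); first exact: measurable_fun_xsection.
by apply/funext => w /=; congr (mu _); apply/seteqP; split => u /=;
  rewrite /xsection/= inE.
Qed.

(** The event of being trapped is a finite union, over the traps, of preimages of the graph of the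
    random set. *)
Lemma measurable_payoff (sigma : attacker_random R) (tau : defender_random R k) :
  attacker_strategy sigma -> defender_strategy tau ->
  measurable_fun setT (fun w : a_space sigma * d_space tau =>
    payoff (a_set sigma w.1) (d_traps tau w.2)).
Proof.
move=> hs [_ mx]; apply: measurable_fun_ifT => //; last first.
  exact: (measurableT_comp (measurable_arc_length _ hs) measurable_fst).
apply: (measurable_fun_bool true); rewrite setTI.
rewrite (_ : _ @^-1` _ = \bigcup_(i in [set: 'I_k])
    (fun w => (w.1, d_traps tau w.2 i)) @^-1`
      [set x | a_set sigma x.1 x.2]); last first.
  apply/seteqP; split => w /=.
    by move=> /asboolP[i xi]; exists i.
  by move=> [i _ xi]; apply/asboolP; exists i.
apply: fin_bigcup_measurable => // i _; rewrite -[X in measurable X]setTI.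
have mf : measurable_fun setT
    (fun w : a_space sigma * d_space tau => (w.1, d_traps tau w.2 i)).
  apply: measurable_fun_pair; first exact: measurable_fst.
  exact: (measurableT_comp (mx i) measurable_snd).
by apply: (mf measurableT [set x | a_set sigma x.1 x.2]); have [_] := hs.
Qed.

Lemma payoff_ge0 (S : set (plane R)) (x : 'I_k -> plane R) : (0 <= payoff S x)%E.
Proof. by rewrite /payoff; case: ifP => // _; exact: measure_ge0. Qed.

Lemma expected_payoff1 (sigma : attacker_random R) (tau : defender_random R k) :
  attacker_strategy sigma -> defender_strategy tau ->
  expected_payoff sigma tau =
  (\int[a_law sigma]_s \int[d_law tau]_t payoff (a_set sigma s) (d_traps tau t))%E.
Proof.
move=> hs ht; rewrite /expected_payoff fubini_tonelli1//.
  exact: measurable_payoff.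
by move=> w; exact: payoff_ge0.
Qed.

Lemma expected_payoff2 (sigma : attacker_random R) (tau : defender_random R k) :
  attacker_strategy sigma -> defender_strategy tau ->
  expected_payoff sigma tau =
  (\int[d_law tau]_t \int[a_law sigma]_s payoff (a_set sigma s) (d_traps tau t))%E.
Proof.
move=> hs ht; rewrite /expected_payoff fubini_tonelli2//.
  exact: measurable_payoff.
by move=> w; exact: payoff_ge0.
Qed.

(** Both [S] and [x] depend on [t], so that one notion covers a random arc against fixed traps and a
    fixed set against rotating traps. *)
Definition untouched {T : Type} (S : T -> set (plane R))
    (x : T -> 'I_k -> plane R) : set T :=
  [set t | forall i, ~ S t (x t i)].

(** Pointwise, the payoff is [a] times the indicator of [untouched S x]. *)
Lemma integral_payoff d (T : measurableType d) (P : {measure set T -> \bar R})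
    (a : \bar R) (S : T -> set (plane R)) (x : T -> 'I_k -> plane R) :
  (0 <= a)%E -> (forall t, arc_length (S t) = a) ->
  measurable (untouched S x) ->
  (\int[P]_t payoff (S t) (x t) = a * P (untouched S x))%E.
Proof.
move=> a0 Sa mU; rewrite -[in RHS](setIT (untouched S x)) -integral_indic//.
rewrite -ge0_integralZl//; last first.
  by apply/measurable_EFinP; exact: measurable_indic.
apply: eq_integral => t _; rewrite /payoff Sa indicE; case: asboolP => [[i Si]|h].
  by rewrite memNset ?mule0// => /(_ i).
by rewrite mem_set ?mule1// => i Si; apply: h; exists i.
Qed.

Context (k1 : (1 <= k)%N).

Let k0 : 0 < k%:R :> R. Proof. by rewrite ltr0n. Qed.
Let l01 : 0 <= (2 * k%:R : R)^-1 < 1.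
Proof.
rewrite invr_ge0 mulr_ge0 ?ltW//= invf_lt1 ?mulr_gt0//.
have : 1 <= k%:R :> R by rewrite ler1n.
by lra.
Qed.

Lemma uniform_interval_guarantee (x : 'I_k -> plane R) : defender_choice x ->
  ((4 * k%:R)^-1%:E <= \int[unif]_t
    payoff (@circle_point R @` `[t, (t + (2 * k%:R)^-1)%R]) x)%E.
Proof.
move=> cx; set l := (2 * k%:R)^-1.
pose F i := [set t | (@circle_point R @` `[t, t + l]) (x i)].
have mF i : measurable (F i) by have [] := uniform_arc_mem _ (x i) l l01 (cx i).
pose S t := @circle_point R @` `[t, t + l].
have UE : untouched S (fun _ => x) = ~` \bigcup_(i in [set: 'I_k]) F i.
  apply/seteqP; split => t /= h.
    by move=> [i _ /h].
  by move=> i Si; apply: h; exists i.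
have mU : measurable (\bigcup_(i in [set: 'I_k]) F i).
  exact: fin_bigcup_measurable.
have /andP[l0 l1] := l01.
rewrite (integral_payoff _ _ unif l%:E S (fun _ => x)); last 3 first.
- by rewrite lee_fin.
- by move=> t; exact: arc_length_arc.
- by rewrite UE; exact: measurableC.
rewrite UE [X in (_ * X)%E](_ : _ = 1 - unif (\bigcup_(i in [set: 'I_k]) F i))%E;
  last exact: (probability_setC unif mU).
have U2 : (unif (\bigcup_(i in [set: 'I_k]) F i) <= (2^-1)%:E)%E.
  (* Union bound, with total [k * l = 1 / 2]; [G] extends the family [F] to all natural indices by
     the empty set. *)
  pose G n := if insub n is Some i then F i else set0.
  have GF (i : 'I_k) : G i = F i by rewrite /G valK.
  apply: (@le_trans _ _ (\sum_(i < k) unif (G i))%E).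
    apply: content_subadditive => //.
      by move=> n /= nk; rewrite (GF (Ordinal nk)); exact: mF.
    move=> t [i _ Fi]; rewrite -bigcup_mkord; exists i; first exact: ltn_ord.
    by rewrite GF.
  rewrite (eq_bigr (fun=> l%:E)) => [|i _].
    rewrite sumEFin sumr_const card_ord lee_fin (_ : l *+ k = 2^-1)//.
    by rewrite -mulr_natr /l; field; rewrite gt_eqF.
  by rewrite GF; have [] := uniform_arc_mem _ (x i) l l01 (cx i).
apply: (@le_trans _ _ (l%:E * (1 - (2^-1)%:E))%E).
  rewrite -EFinB -EFinM lee_fin (_ : (4 * k%:R)^-1 = l * (1 - 2^-1))//.
  by rewrite /l; field; rewrite gt_eqF.
by rewrite lee_wpmul2l ?lee_fin// leeB.
Qed.

Lemma equidistant_guarantee (S : set (plane R)) :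
  attacker_choice S -> measurable S ->
  (\int[unif]_t payoff S (fun i : 'I_k => circle_point (t + i%:R / k%:R)%R)
     <= (4 * k%:R)^-1%:E)%E.
Proof.
move=> [Scirc Sconn] mS; set d := k%:R^-1 : R.
have d0 : 0 < d by rewrite invr_gt0.
have d1 : d <= 1 by rewrite invf_le1// ler1n.
have kd : k%:R * d = 1 by rewrite mulfV// gt_eqF.
pose A := @circle_point R @^-1` S.
have mA : measurable A.
  rewrite -[X in measurable X]setTI.
  by apply: (measurable_circle_point R measurableT).
have A1 u : A (u + 1) = A u by rewrite /A/preimage/mkset circle_pointD1.
pose x t (i : 'I_k) := circle_point (t + i%:R / k%:R) : plane R.
pose T := untouched (fun _ : R => S) x.
have TE : T = ~` \bigcup_(i in [set: 'I_k]) ((fun t => t + i%:R / k%:R) @^-1` A).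
  apply/seteqP; split => t /= h.
    by move=> [i _ /h].
  by move=> i Si; apply: h; exists i.
have mT : measurable T.
  rewrite TE; apply: measurableC; apply: fin_bigcup_measurable => // i _.
  exact: measurable_shift.
have Tn t : T t -> forall j, (j < k)%N -> ~ A (t + j%:R / k%:R).
  by move=> Tt j jk; exact: (Tt (Ordinal jk)).
have dS (t : R) j : t + j.+1%:R / k%:R = t + d + j%:R / k%:R.
  by rewrite -natr1 mulrDl mul1r -addrA [d + _]addrC.
have tk (t : R) : t + k%:R / k%:R = t + 1 by rewrite divff// gt_eqF.
(* Rotating by [d] sends each trap to the next one and the last to the first, a full turn further,
   where [A1] applies. *)
have Td t : T (t + d) = T t.
  apply/propext; split => /Tn h [j jk] /=; rewrite /x/= -[S _]/(A _).
    case: j jk => [|j] jk; last by have := h j (ltnW jk); rewrite -dS.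
    by have := h k.-1; rewrite -dS prednK// tk A1 mul0r addr0; apply.
  move: jk; rewrite leq_eqVlt => /predU1P[jk|jk].
    rewrite -dS jk tk A1.
    by have := h 0%N k1; rewrite mul0r addr0.
  by rewrite -dS; exact: h.
rewrite (integral_payoff _ _ unif (arc_length S) (fun=> S) x) //.
rewrite -/T.
(* If no rotation misses [S], or if [A] is empty, the expected payoff is 0. *)
have [->|/set0P[t0 Tt0]] := eqVneq T set0.
  by rewrite measure0 mule0 lee_fin invr_ge0 mulr_ge0// ltW.
have [A0|/set0P[u Au]] := eqVneq A set0.
  by rewrite /arc_length -/A A0 setI0 measure0 mul0e lee_fin invr_ge0 mulr_ge0// ltW.
(* A point [u] of [A] selects the gap: [t0] is translated by a multiple of [d] to a [c] with [u] in
   [[c, c + d[]. As [T] is [d]-periodic, [S] avoids both ends. *)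
have [m /andP[cu uc]] := int_window _ t0 d u d0.
pose c := t0 - m%:~R * d.
have Tc : T c.
  by rewrite -(periodic_int _ _ _ _ m Td) /c subrK.
have T0 t : T t -> ~ A t.
  by move=> /(_ (Ordinal k1)); rewrite /x/= mul0r addr0.
have nAc : ~ A c by exact: T0.
have nAcd : ~ A (c + d) by apply: T0; rewrite Td.
(* [b] is the midpoint of the gap and [e] the common value of [g] at its two ends; for [k = 1] these
   are one point, opposite to [b]. *)
pose b := c + d / 2.
pose g := scal R b.
pose e := cos (pi * d) / (pi *+ 2) : R.
have d01 : 0 <= d <= 1 by rewrite ltW.
have cltu : c < u.
  rewrite lt_neqAle /c lerBlDr cu andbT; apply/eqP => cE; apply: nAc.
  by rewrite /c cE.
have ucd : u < c + d by rewrite /c; move: uc; set z := m%:~R * d; lra.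
have gu : e < g (circle_point u).
  rewrite /g scal_circle_point /e ltr_pM2r ?invr_gt0// ltr_cos_window//.
    by rewrite ltr_norml /b; apply/andP; split; lra.
  by rewrite ler_norml /b; apply/andP; split; lra.
(* On the circle, [g] equals [e] only at the two traps bounding the gap around [b];
   as [S] avoids them and is connected, [g] stays above [e] on [S]. *)
have gne p : S p -> g p != e.
  move=> Sp; have [v pv] := circle_pointP R p (Scirc _ Sp).
  have [w wv wb] := circle_point_near R b v.
  have Aw : A w by rewrite /A/preimage/mkset wv -pv.
  apply/negP => /eqP gpe; move: gpe; rewrite pv -wv /g scal_circle_point /e.
  move=> /(mulIf (invr_neq0 (lt0r_neq0 twopi0))) cE.
  have lew : `|w - b| <= d / 2 by rewrite -ler_cos_window// cE.
  have : ~~ (`|w - b| < d / 2) by rewrite -ltr_cos_window// cE ltxx.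
  rewrite -leNgt => gew; have : `|w - b| = d / 2 by apply/le_anti; rewrite lew.
  case: (ger0P (w - b)) => _ wbd.
    by apply: nAcd; rewrite (_ : c + d = w)//; move: wbd; rewrite /b; lra.
  by apply: nAc; rewrite (_ : c = w)//; move: wbd; rewrite /b; lra.
have gS p : S p -> e < g p.
  move=> Sp; rewrite ltNge; apply/negP => gpe.
  have /connected_intervalP gI : connected (g @` S).
    apply: connected_continuous_connected => //.
    by apply: continuous_subspaceT; exact: continuous_scal.
  have [q Sq /eqP] : (g @` S) e.
    apply: (gI (g p) (g (circle_point u))).
    - by exists p.
    - by exists (circle_point u).
    by rewrite gpe ltW.
  by apply/negP; exact: gne.
(* The unit window is recentred at [b], where [e < g] means being at distance less than [d / 2] from
   [b]. *)
have sq : (arc_length S <= mu (`[c, (c + d)%R[ `&` A))%E.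
  have -> : arc_length S = mu (`[0, (0 + 1)%R[ `&` A) by rewrite add0r.
  rewrite (lebesgue_periodic_window R A 1 ltr01 mA A1 0 (b - 2^-1)).
  apply: le_measure; rewrite ?inE; [exact: measurableI|exact: measurableI|].
  move=> v /= [+ Av]; rewrite !in_itv/= => /andP[lo hi]; split => //.
  have := gS _ Av.
  rewrite /g scal_circle_point /e ltr_pM2r ?invr_gt0// ltr_cos_window//.
    by rewrite ltr_norml /b => /andP[? ?]; apply/andP; split; lra.
  by rewrite ler_norml; apply/andP; split; lra.
have UT : unif T = (k%:R%:E * mu (`[c, (c + d)%R[ `&` T))%E.
  rewrite uniform_prob01E// -{1}kd lebesgue_periodic_mul//.
  by rewrite (lebesgue_periodic_window R T d d0 mT Td c 0) add0r.
have pq : (mu (`[c, (c + d)%R[ `&` T) + mu (`[c, (c + d)%R[ `&` A) <= d%:E)%E.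
  rewrite -measureU; [|exact: measurableI|exact: measurableI|]; last first.
    by apply/seteqP; split => t //= [[_ /T0 nA] [_]].
  have -> : d%:E = mu `[c, c + d[.
    rewrite lebesgue_measure_itv/= lte_fin ltrDl d0 -EFinD.
    by congr EFin; ring.
  apply: le_measure; rewrite ?inE//.
    by apply: measurableU; exact: measurableI.
  by move=> t [[]|[]].
rewrite [X in (_ * X)%E](_ : _ = k%:R%:E * mu (`[c, (c + d)%R[ `&` T))%E;
  last exact: UT.
apply: le_trans (lee_wpmul2r _ sq) _; first by rewrite mule_ge0 ?lee_fin.
move: pq.
have : (0 <= mu (`[c, (c + d)%R[ `&` T))%E by exact: measure_ge0.
have : (0 <= mu (`[c, (c + d)%R[ `&` A))%E by exact: measure_ge0.
case: (mu (_ `&` A)) => [q| |]; case: (mu (_ `&` T)) => [p| |] //.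
rewrite -!EFinM -EFinD !lee_fin => q0 p0 pqd.
(* [k p (d - p)] is maximal at [p = d / 2] *)
have -> : (4 * k%:R)^-1 = k%:R * (d / 2) ^+ 2 :> R.
  by rewrite /d; field; rewrite gt_eqF.
rewrite mulrCA ler_pM2l//.
have := sqr_ge0 (p - d / 2); nra.
Qed.

End game.

(** * The value and the optimal strategies *)

Lemma equidistant_traps_strategy (R : realType) (k : nat) :
  defender_strategy (equidistant_traps R k).
Proof.
split=> [t i|i] /=; first exact: circle_circle_point.
apply: (measurableT_comp (measurable_circle_point R)).
by apply: measurable_funD; [exact: measurable_id|exact: measurable_cst].
Qed.

(** The guarantees of [sigma] and [tau] bound the lower value from below and the upper value from
    above; the opposite bounds come from answering an arbitrary opponent with [tau] or [sigma]. *)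
Lemma game_value_of_guarantees (R : realType) (k : nat) (v : \bar R)
    (sigma : attacker_random R) (tau : defender_random R k) :
  attacker_strategy sigma -> defender_strategy tau ->
  (forall tau' : defender_random R k,
    defender_strategy tau' -> (v <= expected_payoff sigma tau')%E) ->
  (forall sigma' : attacker_random R,
    attacker_strategy sigma' -> (expected_payoff sigma' tau <= v)%E) ->
  is_game_value k v.
Proof.
move=> hs ht hv vh; split; apply/eqP; rewrite eq_le; apply/andP; split.
- apply: ge_ereal_sup => _ [s ss ->].
  by apply: le_trans (vh _ ss); apply: ereal_inf_lbound; exists tau.
- apply: le_trans (ereal_sup_ubound _); last by exists sigma.
  by apply: le_ereal_inf_tmp => _ [t tt ->]; exact: hv.
- apply: le_trans (ereal_inf_lbound _) _; first by exists tau.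
  by apply: ge_ereal_sup => _ [s ss ->]; exact: vh.
- apply: le_ereal_inf_tmp => _ [t tt ->].
  by apply: le_trans (hv _ tt) _; apply: ereal_sup_ubound; exists sigma.
Qed.

Theorem theorem2 (R : realType) (k : nat) (hk : (1 <= k)%N) :
  [/\ attacker_optimal k (uniform_interval (2 * k%:R : R)^-1),
      defender_optimal (equidistant_traps R k) &
      is_game_value k ((4 * k%:R : R)^-1)%:E].
Proof.
have hs : attacker_strategy (uniform_interval (2 * k%:R : R)^-1).
  apply: uniform_interval_strategy; rewrite invr_ge0 mulr_ge0//=.
  have : 1 <= k%:R :> R by rewrite ler1n.
  by move=> k1; rewrite invf_lt1; lra.
have ht := equidistant_traps_strategy R k.
have v_ge (tau : defender_random R k) : defender_strategy tau ->
    (((4 * k%:R : R)^-1)%:E <=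
      expected_payoff (uniform_interval (2 * k%:R : R)^-1) tau)%E.
  (* Integrating over the attacker first fixes the traps; the bound for pure placements is then
     averaged over [d_law tau]. *)
  move=> htau; rewrite expected_payoff2//.
  rewrite -[leLHS]mule1 -(@probability_setT _ _ _ (d_law tau)) -integral_cst//.
  apply: ge0_le_integral => //.
  - by move=> t _; rewrite lee_fin invr_ge0 mulr_ge0.
  - have mp := measurable_payoff _ _ _ _ hs htau.
    by apply: (measurable_fun_fubini_tonelli_G _ mp) => w; exact: payoff_ge0.
  - by move=> t _; apply: uniform_interval_guarantee => //; have [+ _] := htau.
have v_le (sigma : attacker_random R) : attacker_strategy sigma ->
    (expected_payoff sigma (equidistant_traps R k) <= ((4 * k%:R : R)^-1)%:E)%E.
  (* Dually, integrating over the rotations first fixes the attacker's set. *)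
  move=> hsigma; rewrite expected_payoff1//.
  rewrite -[leRHS]mule1 -(@probability_setT _ _ _ (a_law sigma)) -integral_cst//.
  apply: ge0_le_integral => //.
  - by move=> s _; apply: integral_ge0 => t _; exact: payoff_ge0.
  - have mp := measurable_payoff _ _ _ _ hsigma ht.
    by apply: (measurable_fun_fubini_tonelli_F _ mp) => w; exact: payoff_ge0.
  - move=> s _; apply: equidistant_guarantee => //; first by have [+ _] := hsigma.
    (* Each realized set is a section of the measurable graph, hence measurable. *)
    have -> : a_set sigma s = xsection [set x | a_set sigma x.1 x.2] s.
      by apply/seteqP; split => p /=; rewrite /xsection/= inE.
    by apply: measurable_xsection; have [_] := hsigma.
have hv := game_value_of_guarantees _ _ _ _ _ hs ht v_ge v_le.
by split=> //; split=> //; exists ((4 * k%:R)^-1)%:E.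
Qed.
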